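(* For even $n$, the perfect matching polytope $P_{\mathrm{perfect\ matching}}(K_n)$ of the complete graph $K_n$ has an $s$--$t$ path extension of size $O(2^{0.695n})$. That is, there is an absolute constant $C>0$ such that for all sufficiently large even integers $n$ there exists an $s$--$t$ path extension of $P_{\mathrm{perfect\ matching}}(K_n)$ of size at most $C\cdot 2^{0.695n}$.
   Context: Perfect matching polytope: a perfect matching of an undirected graph $G=(V(G),E(G))$ is a set of edges $M\subseteq E(G)$ such that every vertex of $G$ is incident to exactly one edge of $M$. $P_{\mathrm{perfect\ matching}}(G)=\operatorname{conv}\{\chi^M\in\mathbb{R}^{E(G)} : M \text{ perfect matching of } G\}$, where $\chi^M$ is the incidence vector of $M$. Path extensions: let $N=(V,A)$ be a finite acyclic directed graph (parallel arcs allowed) with source $s\in V$ and sink $t\in V\setminus\{s\}$. Its $s$--$t$ path polytope is $Q=\operatorname{conv}\{\chi^\sigma\in\mathbb{R}^A:\sigma \text{ a directed } s\text{--}t \text{ path in } N\}$, where $\chi^\sigma$ is the characteristic vector of the arc set of $\sigma$. $Q$ is an $s$--$t$ path extension of a polytope $P\subseteq\mathbb{R}^d$ if there is a linear map $\pi:\mathbb{R}^A\to\mathbb{R}^d$ with $\pi(Q)=P$. Its size is the number of arcs $|A|$. *)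

(* Defs.v *)
From HB Require Import structures.
From mathcomp Require Import all_boot all_order all_algebra.
From mathcomp Require Import all_classical all_reals all_analysis.

Set Implicit Arguments.
Unset Strict Implicit.
Unset Printing Implicit Defensive.

Import Order.TTheory GRing.Theory Num.Theory.
Local Open Scope classical_set_scope.
Local Open Scope ring_scope.

(* The space R^I. The codomain is R^o because the lmodType structure on finite
   functions requires the codomain to be an lmodType. *)
Definition coord_space (R : realType) (I : finType) : lmodType R :=
  {ffun I -> R^o}.

Definition char_vec (R : realType) (I : finType) (S : {set I}) :
    coord_space R I :=
  [ffun i => (i \in S)%:R].

Definition conv_hull (R : realType) (E : lmodType R) (X : set E) : set E :=
  smallest (@convex_set R E) X.

Record sgraph := SGraph {
  vertex : finType;
  edge_set : {set {set vertex}};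
  edge_card2 : forall e, e \in edge_set -> #|e| = 2%N }.

Definition edge (G : sgraph) : finType :=
  {e : {set vertex G} | e \in edge_set G}.

Definition perfect_matching (G : sgraph) (M : {set edge G}) : bool :=
  [forall v : vertex G, #|[set e in M | v \in val e]| == 1%N].

Definition perfect_matching_polytope (R : realType) (G : sgraph) :
    set (coord_space R (edge G)) :=
  conv_hull [set char_vec R M | M in [set M | perfect_matching M]].
Arguments perfect_matching_polytope R G : clear implicits.

Lemma complete_edge_card2 (n : nat) (e : {set 'I_n}) :
  e \in [set e : {set 'I_n} | #|e| == 2%N]%SET -> #|e| = 2%N.
Proof. by rewrite inE => /eqP. Qed.

Definition complete_graph (n : nat) : sgraph :=
  SGraph (@complete_edge_card2 n).

(* Arcs form a type of their own, so parallel arcs are allowed. *)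
Record digraph := Digraph {
  node : finType;
  arc : finType;
  arc_tail : arc -> node;
  arc_head : arc -> node }.

Fixpoint diwalk (D : digraph) (x : node D) (p : seq (arc D)) (y : node D) :
    bool :=
  if p is a :: p' then (arc_tail a == x) && diwalk (arc_head a) p' y else x == y.

Definition dipath (D : digraph) (x : node D) (p : seq (arc D)) (y : node D) :
    bool :=
  diwalk x p y && uniq (x :: [seq arc_head a | a <- p]).

(* A shortest nonempty closed walk is a directed cycle, so excluding nonempty
   closed walks excludes exactly the directed cycles (loops included). *)
Definition acyclic (D : digraph) : Prop :=
  forall (x : node D) (p : seq (arc D)), diwalk x p x -> p = [::].

Record st_network := STNetwork {
  net :> digraph;
  source : node net;
  sink : node net;
  sink_neq_source : sink != source;
  net_acyclic : acyclic net }.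

Definition path_polytope (R : realType) (N : st_network) :
    set (coord_space R (arc N)) :=
  conv_hull [set char_vec R [set a in p]%SET
       | p in [set p | dipath (source N) p (sink N)]].
Arguments path_polytope R N : clear implicits.

Definition is_path_extension (R : realType) (I : finType)
    (P : set (coord_space R I)) (N : st_network) : Prop :=
  exists pi : {linear coord_space R (arc N) -> coord_space R I},
    pi @` path_polytope R N = P.

Definition network_size (N : st_network) : nat := #|arc N|.

(* Main.v *)
From HB Require Import structures.
From Pilot Require Import Defs.
From mathcomp Require Import all_boot all_order all_algebra.
From mathcomp Require Import all_classical all_reals all_analysis.
From mathcomp Require Import zify lra.

(** Build a perfect matching of [K_n] by repeatedly matching the smallest
    unmatched vertex. The set [S] of matched vertices then runs along a path
    from the empty set to the full vertex set in the network whose arcs are the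
    pairs [(S, e)] with [e] disjoint from [S] and covering the smallest vertex
    outside [S]; paths correspond to perfect matchings, and summing the arc
    coordinates over all arcs labelled [e] projects the path polytope onto the
    matching polytope. After [k] steps [S] has [2k] elements and contains the
    first [k] vertices, so there are at most ['C(n - k, k)] such [S]. These
    binomials sum to a Fibonacci number, and the golden ratio is
    about [2 ^ 0.6943], which leaves room for a polynomial factor. *)

Set Implicit Arguments.
Unset Strict Implicit.
Unset Printing Implicit Defensive.
Import Order.TTheory GRing.Theory Num.Theory.
Import mathcomp.boot.finset Pilot.Defs.

(** * Preliminary estimates, and convex hulls under linear maps *)

(* The fraction 89 / 55 slightly exceeds the golden ratio: with y = 55 / 89 one
   has y + y ^ 2 <= 1, so each term 'C(m, k) y ^ (m - k) (y ^ 2) ^ k is at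
   most 1. *)
Lemma binomial_weight_le (m k : nat) : (k <= m -> 'C(m, k) * 55 ^ (m + k) <= 89 ^ (m + k))%N.
Proof.
move=> le_km.
have h : 'C(m, k) * (55 * 89) ^ (m - k) * (55 ^ 2) ^ k <= (89 ^ 2) ^ m.
  have := @expnDn (55 * 89) (55 ^ 2) m.
  rewrite (bigD1 (inord k)) //= inordK ?ltnS // => e.
  (* [55 * 89 + 55 ^ 2 = 7920] falls one short of [89 ^ 2 = 7921]. *)
  apply: (@leq_trans ((55 * 89 + 55 ^ 2) ^ m));
    last by case: (posnP m) => [->|m0] //; rewrite leq_exp2r.
  by rewrite e mulnA leq_addr.
have e : (89 ^ 2) ^ m = 89 ^ (m + k) * 89 ^ (m - k).
  by rewrite -expnD -expnM; congr expn; lia.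
have e' : (55 * 89) ^ (m - k) * (55 ^ 2) ^ k = 55 ^ (m + k) * 89 ^ (m - k).
  by rewrite expnMn -expnM mulnAC -expnD; congr (55 ^ _ * _); lia.
by rewrite -(@leq_pmul2r (89 ^ (m - k))) ?expn_gt0 // -e -mulnA -e' mulnA.
Qed.

Local Open Scope ring_scope.

(** Preimages and images of convex sets under a linear map are convex; each fact gives one
    inclusion, by minimality of the hull. *)
Lemma image_conv_hull (R : realType) (E F : lmodType R)
    (f : {linear E -> F}) (X : set E) :
  (f @` conv_hull X = conv_hull (f @` X))%classic.
Proof.
apply/seteqP; split=> [_ [x hx <-]|].
  move: x hx; apply: (@smallest_sub _ _ _ (f @^-1` conv_hull (f @` X))%classic).
    move=> x y l /set_mem hx /set_mem hy; apply/mem_set.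
    rewrite /preimage /= /conv /= linearD !linearZ => C [cC sC].
    by apply/set_mem/cC; apply/mem_set; [exact: hx|exact: hy].
  by move=> x hx C [_ sC]; apply: sC; exists x.
apply: smallest_sub => [_ _ l /set_mem[x hx <-] /set_mem[y hy <-]|_ [x hx <-]].
  apply/mem_set; exists (conv l (x : convex_lmodType E) (y : convex_lmodType E));
    last by rewrite /conv /= linearD !linearZ.
  move=> C [cC sC]; apply/set_mem/cC; apply/mem_set; [exact: hx|exact: hy].
by exists x => // C [_ sC]; apply: sC.
Qed.

(** Bernoulli's inequality gives [n * (c - 1) <= c ^+ n], whence [K = 1 + (c - 1)^-1]. *)
Lemma linear_le_exp (R : realType) (c : R) : 1 < c ->
  exists2 K : R, 0 < K & forall n : nat, n.+1%:R <= K * c ^+ n.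
Proof.
move=> c1; exists (1 + (c - 1)^-1) => [|n].
  by rewrite addr_gt0 ?invr_gt0 ?subr_gt0.
have dgt0 : 0 < c - 1 by rewrite subr_gt0.
have bernoulli : 1 + n%:R * (c - 1) <= c ^+ n.
  elim: n => [|n IH]; first by rewrite expr0 mul0r addr0.
  rewrite exprS -natr1; have n0 : 0 <= n%:R :> R by [].
  have := ler_wpM2l (ltW (lt_trans ltr01 c1)) IH.
  have : 0 <= n%:R * (c - 1) * (c - 1) by rewrite !mulr_ge0 // ltW.
  nra.
have n0 : 0 <= n%:R * (c - 1) by rewrite mulr_ge0 // ltW.
have : n%:R <= (c - 1)^-1 * c ^+ n.
  rewrite mulrC ler_pdivlMr //; lra.
rewrite mulrDl mul1r -natr1; lra.
Qed.

(* 139 = 0.695 * 200: this says 89 / 55 < 2 ^ 0.695. *)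
Lemma ratio_89_55_bound : (89 ^ 200 < 2 ^ 139 * 55 ^ 200)%N.
Proof. by lia. Qed.

(** The ratio [b] of [2 ^ 0.695] to [89 / 55] exceeds 1, hence so does its cube root [c]; up to a
    constant, [c ^+ n] dominates each of the three factors [n.+1]. *)
Lemma cube_exp_le_powR (R : realType) :
  exists2 C : R, 0 < C &
    forall n : nat, (n.+1 ^ 3 * 89 ^ n)%:R <= C * 2 `^ (695 / 1000 * n%:R) * 55 ^+ n.
Proof.
pose B : R := 2 `^ (695 / 1000).
have B0 : 0 < B by rewrite powR_gt0.
have B200 : B ^+ 200 = 2 ^+ 139.
  rewrite -!powR_mulrn ?ltW // -powRrM; congr powR.
  by lra.
pose b := B * 55 / 89.
have b1 : 1 < b.
  rewrite /b ltr_pdivlMr // mul1r -(@ltr_pXn2r _ 200) // ?nnegrE ?mulr_ge0 ?ltW //.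
  rewrite exprMn B200.
  rewrite -!natrX -natrM ltr_nat; exact: ratio_89_55_bound.
pose c := b `^ 3^-1.
have c3 : c ^+ 3 = b.
  by rewrite -powR_mulrn ?powR_ge0 // -powRrM mulVf // powRr1 // ltW // (lt_trans ltr01).
have c1 : 1 < c.
  rewrite -(@ltr_pXn2r _ 3) // ?nnegrE ?powR_ge0 // c3 expr1n //.
have [K K0 hK] := linear_le_exp c1.
exists (K ^+ 3); first by rewrite exprn_gt0.
move=> n; rewrite natrM !natrX powRrM -/B powR_mulrn ?(ltW B0) //.
have -> : B ^+ n = c ^+ n ^+ 3 * (89 / 55) ^+ n.
  rewrite -exprM mulnC exprM c3 -exprMn /b; congr (_ ^+ _); lra.
rewrite mulrA -exprMn -mulrA -exprMn divfK //.
by rewrite ler_pM2r ?exprn_gt0 // lerXn2r // nnegrE ?mulr_ge0 ?exprn_ge0 ?ltW // ?(lt_trans ltr01).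
Qed.

(** * Counting the reachable sets *)

(* The sets of matched vertices that the greedy process can reach: of size 2k
   and containing the first k vertices. *)
Definition prefix_sets (n : nat) : {set {set 'I_n}} :=
  [set S : {set 'I_n} | ~~ odd #|S| &
     [forall i : 'I_n, (i < #|S|./2)%N ==> (i \in S)]]%SET.

Lemma card_ord_lt (n k : nat) : (k <= n)%N -> #|[set i : 'I_n | (i < k)%N]%SET| = k.
Proof.
move=> le_kn; have inj : injective (widen_ord le_kn) by move=> i j /(congr1 val) /= /val_inj.
rewrite -[RHS]card_ord -(card_imset _ inj).
apply: eq_card => i; rewrite inE; apply/idP/imsetP => [lt_ik|[j _ ->]] /=; last exact: ltn_ord.
by exists (Ordinal lt_ik) => //; apply/val_inj.
Qed.

(** Removing the first [k] vertices is injective on these sets and leaves [k] of the other [n - k]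
    vertices. *)
Lemma card_prefix_sets_half (n k : nat) :
  (#|[set S in prefix_sets n | #|S|./2 == k]%SET| <= 'C(n - k, k))%N.
Proof.
case: (leqP k n) => [le_kn|lt_nk]; last first.
  rewrite bin_small; last by lia.
  rewrite leqn0 cards_eq0; apply/set0Pn => -[S]; rewrite !inE => /andP[_ /eqP e].
  have := subset_leq_card (subsetT S); rewrite cardsT card_ord; lia.
pose P := [set i : 'I_n | (i < k)%N]%SET.
have cP : #|P| = k by exact: card_ord_lt.
have -> : (n - k)%N = #|~: P| by have := cardsC P; rewrite cP card_ord; lia.
rewrite -cards_draws.
set X := [set S in _ | _]%SET.
have PX S : S \in X -> P \subset S /\ #|S| = k.*2.
  rewrite !inE => /andP[/andP[ev /forallP h] /eqP e]; split; last by lia.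
  by apply/fintype.subsetP => i; rewrite inE -e; apply: (implyP (h i)).
rewrite -(@card_in_imset _ _ (fun S => S :\: P)%SET X) => [|S T /PX[sS _] /PX[sT _] e].
  apply/subset_leq_card/fintype.subsetP => _ /imsetP[S /PX[sS cS] ->].
  rewrite inE subDset setUCr subsetT /= cardsD (setIidPr sS) cP cS; apply/eqP; lia.
by rewrite -(setID S P) -(setID T P) e (setIidPr sS) (setIidPr sT).
Qed.

Lemma card_prefix_sets (n : nat) :
  (#|prefix_sets n| <= \sum_(k < n.+1) 'C(n - k, k))%N.
Proof.
rewrite -sum1_card (partition_big (fun S : {set 'I_n} => inord #|S|./2 : 'I_n.+1) xpredT) //=.
apply: leq_sum => k _; apply: leq_trans (card_prefix_sets_half n k).
rewrite sum1_card; apply/subset_leq_card/fintype.subsetP => S; rewrite !inE unfold_in /= => /andP[SP /eqP <-].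
have := subset_leq_card (subsetT S); rewrite cardsT card_ord => h.
rewrite inordK ?eqxx; first by move: SP; rewrite inE => ->.
by rewrite ltnS -divn2; apply: leq_trans (leq_div _ _) h.
Qed.

Lemma card_prefix_sets_le (n : nat) :
  (#|prefix_sets n| * 55 ^ n <= n.+1 * 89 ^ n)%N.
Proof.
apply: leq_trans (leq_mul (card_prefix_sets n) (leqnn _)) _.
rewrite big_distrl /= -[n.+1 in leqRHS]card_ord -sum_nat_const.
(* [binomial_weight_le] applies with [m = n - k]; when [k > n - k] the binomial vanishes. *)
apply: leq_sum => k _; case: (leqP k (n - k)) => [le_k|lt_k]; last by rewrite bin_small.
by have := binomial_weight_le le_k; rewrite subnK // -ltnS.
Qed.

(** * The network and its number of arcs *)

(** The last two conditions make [v] the smallest vertex outside [a.1]: disjointness keeps [v] out,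
    and everything below [v] is in. *)
Definition arc_ok (n : nat) (a : {set 'I_n} * edge (complete_graph n)) : bool :=
  [&& a.1 \in prefix_sets n, [disjoint a.1 & val a.2]
    & [exists v in val a.2, [forall u : 'I_n, (u < v)%N ==> (u \in a.1)]]].

(** All vertex sets are nodes, since only arcs count towards the size; arcs leave prefix sets
    only. *)
Definition matching_digraph (n : nat) : digraph :=
  @Digraph {set 'I_n} {a : {set 'I_n} * edge (complete_graph n) | arc_ok a}
    (fun a => (val a).1) (fun a => (val a).1 :|: val (val a).2)%SET.

Definition arc_edge (n : nat) (a : arc (matching_digraph n)) : edge (complete_graph n) :=
  (val a).2.

Lemma card_edge_complete_graph (n : nat) : (#|{: edge (complete_graph n)}| <= n.+1 ^ 2)%N.
Proof.
rewrite card_sig /=.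
apply: (@leq_trans #|[set e : {set 'I_n} | #|e| == 2]%SET|).
  by apply/subset_leq_card/fintype.subsetP => e; rewrite !inE.
rewrite card_draws card_ord bin2 -divn2 expnS expn1.
by apply: leq_trans (leq_div _ _) _; nia.
Qed.

Lemma card_arc_matching_digraph (n : nat) :
  (#|arc (matching_digraph n)| * 55 ^ n <= n.+1 ^ 3 * 89 ^ n)%N.
Proof.
have le_arc : (#|arc (matching_digraph n)| <= #|prefix_sets n| * n.+1 ^ 2)%N.
  rewrite card_sig /=.
  apply: (@leq_trans #|setX (prefix_sets n) [set: edge (complete_graph n)]|).
    by apply/subset_leq_card/fintype.subsetP => -[S e] /and3P[SP _ _]; rewrite in_setX SP in_setT.
  by rewrite cardsX cardsT leq_mul2l card_edge_complete_graph orbT.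
apply: leq_trans (leq_mul le_arc (leqnn _)) _.
rewrite mulnAC [leqRHS](_ : _ = n.+1 * 89 ^ n * n.+1 ^ 2)%N; last by rewrite expnS mulnAC.
by rewrite leq_mul2r card_prefix_sets_le orbT.
Qed.

(** * Walks in the network *)

Lemma arc_tail_disjoint (n : nat) (a : arc (matching_digraph n)) :
  [disjoint (arc_tail a : {set 'I_n}) & val (arc_edge a)].
Proof. by have /and3P[] := valP a. Qed.

Lemma card_arc_head (n : nat) (a : arc (matching_digraph n)) :
  #|(arc_head a : {set 'I_n})| = (#|(arc_tail a : {set 'I_n})| + 2)%N.
Proof.
rewrite cardsU disjoint_setI0 ?arc_tail_disjoint // cards0 subn0.
by congr addn; apply: (edge_card2 (valP (arc_edge a))).
Qed.

(** If [S] has [2k] elements and contains the first [k] vertices, its smallest missing vertex is at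
    least [k], so adding that vertex secures the first [k + 1]. *)
Lemma arc_head_prefix_sets (n : nat) (S : {set 'I_n}) (e : edge (complete_graph n)) :
  arc_ok (S, e) -> (S :|: val e)%SET \in prefix_sets n.
Proof.
move=> ok; case/and3P: (ok) => /= SP dis /exists_inP[v ve /forallP minv].
have := card_arc_head (Sub (S, e) ok : arc (matching_digraph n)); rewrite /= => cU.
move: SP; rewrite !inE cU => /andP[evS /forallP SP].
rewrite addn2 /= negbK evS; apply/forallP => i; apply/implyP; rewrite ltnS => le_i.
rewrite inE.
case: (ltngtP i v) => [lt_iv|lt_vi|/val_inj ->]; last by rewrite ve orbT.
  by rewrite (implyP (minv i)).
have /(implyP (SP v)) vS : (v < #|S|./2)%N by apply: leq_trans lt_vi le_i.
by have := disjointFr dis vS; rewrite ve.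
Qed.

Lemma diwalk_card (n : nat) (S T : node (matching_digraph n)) p :
  diwalk S p T -> #|(T : {set 'I_n})| = (#|(S : {set 'I_n})| + (size p).*2)%N.
Proof.
elim: p S => [|a p IHp] S /=; first by move=> /eqP ->; rewrite addn0.
by case/andP=> /eqP <- /IHp ->; rewrite card_arc_head doubleS -addnA.
Qed.

Lemma matching_digraph_acyclic (n : nat) : acyclic (matching_digraph n).
Proof. by move=> S p /diwalk_card; case: p => // a p /=; lia. Qed.

(** Cardinalities strictly increase along a walk, so no node repeats. *)
Lemma diwalk_dipath (n : nat) (S T : node (matching_digraph n)) p :
  diwalk S p T -> dipath S p T.
Proof.
move=> walk; rewrite /dipath walk.
have : path (fun X Y : {set 'I_n} => #|X| < #|Y|)%N S [seq arc_head a | a <- p].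
  elim: p S walk => //= a p IHp S /andP[/eqP <- walk].
  by rewrite card_arc_head addn2 ltnW //= IHp.
apply: (@sorted_uniq _ _ _ _ (S :: _)); first by move=> ? ? ?; apply: ltn_trans.
by move=> X; rewrite ltnn.
Qed.

(** The edge of an arc is disjoint from its tail, so a vertex is covered only by the arc at which it
    enters the set. *)
Lemma diwalk_count (n : nat) (S T : node (matching_digraph n)) p (v : 'I_n) :
  diwalk S p T ->
  (count (fun e : edge (complete_graph n) => v \in val e) [seq arc_edge a | a <- p]
    + (v \in (S : {set 'I_n})) = (v \in (T : {set 'I_n})) :> nat)%N.
Proof.
elim: p S => [|a p IHp] S /=; first by move=> /eqP ->.
case/andP=> /eqP <- /IHp <-; rewrite inE addnAC [RHS]addnC; congr (_ + _)%N.
have := arc_tail_disjoint a; rewrite /arc_edge /=.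
by case: (boolP (v \in sval (sval a).2)) => [ve dis|_ _]; rewrite ?(disjointFl dis ve) ?orbF ?orbT.
Qed.

(** * Source-sink walks and perfect matchings *)

Definition matching_network (n : nat) (n0 : [set: 'I_n] != set0) : st_network :=
  @STNetwork (matching_digraph n) set0 [set: 'I_n] n0 (@matching_digraph_acyclic n).

Lemma complete_edge_mem (n : nat) (e : edge (complete_graph n)) : exists v, v \in val e.
Proof.
by apply/set0Pn; rewrite -card_gt0 (edge_card2 (valP e)).
Qed.

(** A repeated label would cover its endpoints twice, against [diwalk_count]. *)
Lemma walk_edges_uniq (n : nat) p :
  diwalk (set0 : node (matching_digraph n)) p [set: 'I_n] ->
  uniq [seq arc_edge a | a <- p].
Proof.
move=> walk; apply/count_mem_uniq => e; have [v ve] := complete_edge_mem e.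
have := diwalk_count v walk; rewrite !inE addn0 => c1.
have le1 : (count_mem e [seq arc_edge a | a <- p] <= 1)%N.
  by rewrite -[leqRHS]c1; apply: sub_count => f /eqP ->.
case: (boolP (e \in _)) => [|/count_memPn -> //].
by rewrite -has_pred1 has_count; lia.
Qed.

Lemma walk_perfect_matching (n : nat) p :
  diwalk (set0 : node (matching_digraph n)) p [set: 'I_n] ->
  perfect_matching (G := complete_graph n) [set e in [seq arc_edge a | a <- p]]%SET.
Proof.
move=> walk; apply/forallP => v; apply/eqP.
have := diwalk_count v walk; rewrite !inE addn0 => c1; rewrite -[RHS]c1.
rewrite -size_filter -(card_uniqP (filter_uniq _ (walk_edges_uniq walk))).
by apply: eq_card => e; rewrite !inE mem_filter andbC.
Qed.

Lemma perfect_matching_edge_eq (G : sgraph) (M : {set edge G}) e f v :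
  perfect_matching M -> e \in M -> f \in M -> v \in val e -> v \in val f -> e = f.
Proof.
move=> /forallP/(_ v)/cards1P[g eg] eM fM ve vf.
have : e \in [set e in M | v \in val e]%SET by rewrite inE eM.
have : f \in [set e in M | v \in val e]%SET by rewrite inE fM.
by rewrite eg !inE => /eqP -> /eqP.
Qed.

Lemma perfect_matching_mem (G : sgraph) (M : {set edge G}) v :
  perfect_matching M -> exists2 e, e \in M & v \in val e.
Proof.
move=> /forallP/(_ v)/cards1P[g eg].
have : g \in [set e in M | v \in val e]%SET by rewrite eg inE.
by rewrite inE => /andP[]; exists g.
Qed.

(** Induction on the number of vertices outside [S], with the invariant that [S] splits no edge of
    [M]; the next arc carries the edge of [M] at the smallest missing vertex. At [S = set0] the walk
    uses all of [M]. *)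
Lemma walk_of_matching (n : nat) (M : {set edge (complete_graph n)}) (S : {set 'I_n}) :
  perfect_matching M -> S \in prefix_sets n ->
  (forall e, e \in M -> (val e \subset S) || [disjoint S & val e]) ->
  exists2 p, diwalk (S : node (matching_digraph n)) p [set: 'I_n]
    & forall e, (e \in [seq arc_edge a | a <- p]) = (e \in M) && [disjoint S & val e].
Proof.
move=> pmM; have [m] := ubnP #|~: S|; elim: m S => // m IHm S lt_m SP MS.
have [S0 | /set0Pn[v0 v0S]] := eqVneq (~: S)%SET set0.
  have -> : S = [set: 'I_n]%SET by rewrite -[S]setCK S0 setC0.
  exists [::] => [|e] //=; have [v ve] := complete_edge_mem e.
  by apply/esym/negP => /andP[_ dis]; have := disjointFr dis (in_setT v); rewrite ve.
case: (@arg_minnP _ v0 [in ~: S]%SET (@nat_of_ord n) v0S) => v vS minv.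
have [e eM ve] := @perfect_matching_mem (complete_graph n) M v pmM.
have dis : [disjoint S & val e].
  have /orP[/fintype.subsetP/(_ v ve) | //] := MS e eM.
  by move: vS; rewrite inE => /negPf ->.
have ok : arc_ok (S, e).
  rewrite /arc_ok /= SP dis; apply/exists_inP; exists v => //.
  apply/forallP => u; apply/implyP; apply: contraLR => uS.
  by rewrite -leqNgt minv // inE.
(* Distinct edges of [M] are disjoint, so [S :|: val e] splits no edge of [M] either. *)
have disM f : f \in M -> f != e -> [disjoint val f & val e].
  move=> fM; apply: contraNT => /pred0Pn[w /= /andP[wf we]].
  by apply/eqP; apply: (@perfect_matching_edge_eq (complete_graph n) M f e w pmM fM eM wf we).
case: (IHm (S :|: val e)%SET) => [|||p walk pE].
- rewrite -ltnS; apply: leq_trans lt_m; rewrite ltnS; apply: proper_card.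
  apply/properP; split; first by rewrite setCS subsetUl.
  by exists v => //; rewrite !inE ve orbT.
- exact: arc_head_prefix_sets ok.
- move=> f fM; have [->|fe] := eqVneq f e; first by rewrite subsetUr.
  rewrite disjoints_subset subUset -!disjoints_subset.
  case/orP: (MS f fM) => [sfS|disf]; first by rewrite (fintype.subset_trans sfS) ?subsetUl.
  by rewrite disf disjoint_sym disM ?orbT.
exists ((Sub (S, e) ok : arc (matching_digraph n)) :: p) => [|f]; first by rewrite /= eqxx.
rewrite inE pE {1}/arc_edge /=.
have [->|fe] := eqVneq f e; first by rewrite eM dis.
case fM: (f \in M) => //=.
by rewrite disjoints_subset subUset -!disjoints_subset [X in _ && X]disjoint_sym disM // andbT.
Qed.

(** * The projection onto the matching polytope *)

Definition edge_projection (R : realType) (n : nat)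
    (x : coord_space R (arc (matching_digraph n))) : coord_space R (edge (complete_graph n)) :=
  [ffun e => \sum_(a | arc_edge a == e) (x : {ffun _ -> R^o}) a].

Lemma edge_projection_is_linear (R : realType) (n : nat) : linear (@edge_projection R n).
Proof.
move=> k x y; apply/ffunP => e; rewrite !ffunE scaler_sumr -big_split /=.
by apply: eq_bigr => a _; rewrite !ffunE.
Qed.

HB.instance Definition _ (R : realType) (n : nat) :=
  GRing.isLinear.Build R (coord_space R (arc (matching_digraph n)))
    (coord_space R (edge (complete_graph n))) _ (@edge_projection R n)
    (@edge_projection_is_linear R n).

(** Coordinate [e] counts the arcs of [p] labelled [e], at most one because labels do not repeat. *)
Lemma edge_projection_walk (R : realType) (n : nat) p :
  diwalk (set0 : node (matching_digraph n)) p [set: 'I_n] ->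
  edge_projection (char_vec R [set a in p]%SET) =
    char_vec R [set e in [seq arc_edge a | a <- p]]%SET.
Proof.
move=> walk; apply/ffunP => e; rewrite !ffunE inE.
rewrite (eq_bigr (fun a => if a \in p then 1 else 0)) => [|a _]; last first.
  by rewrite ffunE inE; case: (a \in p).
rewrite -big_mkcondr /= sumr_const -(count_uniq_mem _ (walk_edges_uniq walk)) count_map.
rewrite -size_filter -(card_uniqP _); last first.
  exact/filter_uniq/(map_uniq (walk_edges_uniq walk)).
by congr (_ *+ _); apply: eq_card => a; rewrite mem_filter.
Qed.

Lemma matching_network_extension (R : realType) (n : nat) (n0 : [set: 'I_n]%SET != set0) :
  is_path_extension (perfect_matching_polytope R (complete_graph n)) (matching_network n0).
Proof.
exists (@edge_projection R n).
rewrite /path_polytope /perfect_matching_polytope image_conv_hull; congr conv_hull.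
apply/seteqP; split=> [_ [_ [p /= /andP[walk _] <-] <-]|_ [M /= pmM <-]].
  by rewrite edge_projection_walk //; exists [set e in [seq arc_edge a | a <- p]]%SET;
     first exact: walk_perfect_matching walk.
have S0 : set0 \in prefix_sets n.
  by rewrite inE cards0 /=; apply/forallP.
have [|p walk pE] := walk_of_matching pmM S0.
  by move=> e _; rewrite disjoint_sym disjoints_subset setC0 subsetT orbT.
exists (char_vec R [set a in p]%SET).
  by exists p => //=; apply: diwalk_dipath.
rewrite edge_projection_walk //; congr char_vec.
apply/setP => e; rewrite inE pE; case: (e \in M) => //=.
by rewrite disjoint_sym disjoints_subset setC0 subsetT.
Qed.

Theorem mainTheorem6 (R : realType) :
  exists2 C : R, 0 < C &
    exists n0 : nat, forall n : nat, (n0 <= n)%N -> ~~ odd n ->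
      exists N : st_network,
        is_path_extension (perfect_matching_polytope R (complete_graph n)) N /\
        (network_size N)%:R <= C * 2 `^ (695 / 1000 * n%:R).
Proof.
have [C C0 hC] := cube_exp_le_powR R.
(* For [n = 0] source and sink would both be the empty set, so the threshold is 1. *)
exists C => //; exists 1%N => n n_gt0 _.
have n0 : [set: 'I_n]%SET != set0 by rewrite -card_gt0 cardsT card_ord.
exists (matching_network n0); split; first exact: matching_network_extension.
rewrite -(@ler_pM2r _ (55 ^+ n)) ?exprn_gt0 //; apply: le_trans (hC n).
by rewrite -natrX -natrM ler_nat; apply: card_arc_matching_digraph.
Qed.
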